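(* For every finite simple graph $G$, the following are equivalent: (i) $A(G)=1$; (ii) $a^*(G)=1$; (iii) $G$ does not contain a fractional perfect matching.
   Context: For graphs $G,H$, the tensor product $G\times H$ has vertex set $V(G)\times V(H)$, with $(u,v)$ adjacent to $(u',v')$ iff $uu'\in E(G)$ and $vv'\in E(H)$; $G^n$ denotes the tensor product of $n$ copies of $G$. The independence ratio is $i(G)=\alpha(G)/|V(G)|$, and $A(G)=\lim_{n\to\infty} i(G^n)$ (the sequence is non-decreasing and bounded, so the limit exists). For a vertex set $I$, $N(I)$ is the set of vertices having a neighbor in $I$. Define $a(G)=\max_{I}\frac{|I|}{|I|+|N(I)|}$ over nonempty independent sets $I$ of $G$, and $a^*(G)=a(G)$ if $a(G)\le \frac12$, $a^*(G)=1$ if $a(G)>\frac12$. A fractional matching of $G=(V,E)$ is $f:E\to\mathbb{R}_{\ge 0}$ with $\sum_{e\ni v} f(e)\le 1$ for all $v\in V$; it is a fractional perfect matching if $\sum_{e\in E}f(e)=|V|/2$. *)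

(* Defs.v *)
From HB Require Import structures.
From mathcomp Require Import all_boot all_order all_algebra.
From mathcomp Require Import all_classical all_reals all_analysis.

Set Implicit Arguments.
Unset Strict Implicit.
Unset Printing Implicit Defensive.

Import Order.TTheory GRing.Theory Num.Theory.
Import numFieldNormedType.Exports.

Local Open Scope ring_scope.

Record sgraph := SGraph {
  vertex :> finType;
  adj : rel vertex;
  adj_sym : symmetric adj;
  adj_irr : irreflexive adj }.

Section TensorProduct.
Variables G H : sgraph.

Definition tensor_adj : rel (G * H)%type :=
  fun p q => adj p.1 q.1 && adj p.2 q.2.

Lemma tensor_adj_sym : symmetric tensor_adj.
Proof. by move=> p q; rewrite /tensor_adj adj_sym (adj_sym p.2). Qed.

Lemma tensor_adj_irr : irreflexive tensor_adj.
Proof. by move=> p; rewrite /tensor_adj adj_irr. Qed.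

Definition tensor : sgraph := SGraph tensor_adj_sym tensor_adj_irr.

End TensorProduct.

(* n copies of G for n >= 1. The neutral element of the tensor product is a
   looped vertex, which is not a simple graph, so the value at n = 0 is a
   dummy (it is G); it plays no role in the limit below. *)
Definition tensor_power (G : sgraph) (n : nat) : sgraph :=
  iter n.-1 (tensor G) G.

Section Invariants.
Variables (R : realType) (G : sgraph).

Definition independent (I : {set G}) : bool :=
  [forall u in I, forall v in I, ~~ adj u v].

Definition independence_number : nat :=
  (\max_(I : {set G} | independent I) #|I|)%N.

(* For the graph without vertices this is 0 / 0 = 0. *)
Definition independence_ratio : R :=
  independence_number%:R / #|G|%:R.

Definition neighborhood (I : {set G}) : {set G} :=
  [set v | [exists u in I, adj u v]].

(* Every ratio is positive, so the default value 0 is attained only when no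
   nonempty independent set exists, i.e. for the graph without vertices. *)
Definition max_expansion_ratio : R :=
  \big[Num.max/0]_(I : {set G} | independent I && (I != finset.set0))
    (#|I|%:R / (#|I| + #|neighborhood I|)%:R).

Definition max_expansion_ratio_star : R :=
  if max_expansion_ratio <= 1 / 2 then max_expansion_ratio else 1.

Definition edges : {set {set G}} :=
  [set [set p.1; p.2]%SET | p in [pred p : G * G | adj p.1 p.2]]%SET.

(* Only the values of f on the edges of G matter. *)
Definition fractional_matching (f : {set G} -> R) : Prop :=
  (forall E, E \in edges -> 0 <= f E) /\
  (forall v : G, \sum_(E in edges | v \in E) f E <= 1).

Definition fractional_perfect_matching (f : {set G} -> R) : Prop :=
  fractional_matching f /\ \sum_(E in edges) f E = #|G|%:R / 2.

End Invariants.

Definition limit_independence_ratio (R : realType) (G : sgraph) : R :=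
  limn (fun n : nat => independence_ratio R (tensor_power G n)).

(* Main.v *)
(* Everything reduces to whether |N(I)| >= |I| for every independent set I.

   If so, Hall's theorem provides a permutation s of V(G) with v adjacent to
   s(v). Averaging the edges {v, s(v)} gives a fractional perfect matching; and
   products of copies of s act in the same way on G^n, so that an independent
   set of G^n is disjoint from its image and i(G^n) <= 1/2. Conversely, a
   fractional perfect matching forces |I| <= |N(I)| by double counting.

   If |N(I)| < |I|, give weight t < 1 to I, 1/t to N(I) and 1 to the other
   vertices. Adjacent vertices have weights with product >= 1, and this persists
   for the product weights on G^n, so the vertices of G^n of weight < 1 are
   independent; by Markov's inequality they miss a fraction at most rho^n of G^n,
   where rho is the average weight on G, and rho < 1 for t close to 1. *)
Require Import Defs.
From mathcomp Require Import all_boot all_order all_algebra.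
From mathcomp Require Import all_classical all_reals all_analysis.
From mathcomp Require Import finset ring lra zify.

Set Implicit Arguments.
Unset Strict Implicit.
Unset Printing Implicit Defensive.

Import Order.TTheory GRing.Theory Num.Theory.
Import numFieldNormedType.Exports.

Local Open Scope ring_scope.

(** * Hall's marriage theorem *)

Section Hall.
Variables T U : finType.
Implicit Types (r : T -> pred U) (A S : {set T}) (u : U).

Definition rel_image r S : {set U} := [set u | [exists x in S, r x u]].

Lemma rel_imageP r S u :
  reflect (exists2 x, x \in S & r x u) (u \in rel_image r S).
Proof. by rewrite inE; apply: exists_inP. Qed.

Lemma rel_imageU r A S :
  rel_image r (A :|: S) = rel_image r A :|: rel_image r S.
Proof.
apply/setP=> u; rewrite in_setU; apply/rel_imageP/orP.
  by move=> [x /setUP[xA|xS] rxu]; [left|right]; apply/rel_imageP; exists x.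
by case=> /rel_imageP[x xA rxu]; exists x => //; rewrite inE xA ?orbT.
Qed.

Lemma rel_image_exclude r (B : {set U}) S :
  rel_image (fun x u => r x u && (u \notin B)) S = rel_image r S :\: B.
Proof.
apply/setP=> u; rewrite in_setD; apply/rel_imageP/andP.
  by move=> [x xS /andP[rxu uB]]; split=> //; apply/rel_imageP; exists x.
by move=> [uB /rel_imageP[x xS rxu]]; exists x; rewrite // rxu.
Qed.

(** Induction on [#|A|] with [r] general, so that elements already used can be excluded from the
    relation; [u0] provides a map when [A] is empty. *)
Lemma hall_in u0 r A :
  (forall S, S \subset A -> (#|S| <= #|rel_image r S|)%N) ->
  exists2 f : T -> U, {in A &, injective f} & {in A, forall x, r x (f x)}.
Proof.
have [n] := ubnP #|A|; elim: n r A => // n IHn r A /ltnSE-leAn hallA.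
have [->|/set0Pn[x xA]] := eqVneq A finset.set0.
  by exists (fun=> u0) => x; rewrite inE.
(* It suffices to find a nonempty S whose matching into B leaves Hall's
   condition intact on the rest: a tight proper S if there is one, and
   otherwise a single vertex matched arbitrarily. *)
suff [S [B [S_neq0 sSA hallD [f1 [inj1 rf1 f1B]]]]] : exists S (B : {set U}),
    [/\ S != finset.set0, S \subset A,
        forall S', S' \subset A :\: S ->
          (#|S'| <= #|rel_image r S' :\: B|)%N &
        exists f : T -> U, [/\ {in S &, injective f},
          {in S, forall x, r x (f x)} & {in S, forall x, f x \in B}]].
  have [f2 inj2 rf2] : exists2 f : T -> U, {in A :\: S &, injective f} &
      {in A :\: S, forall x, r x (f x) && (f x \notin B)}.
    apply: (IHn (fun y u => r y u && (u \notin B))) => [|S' sS'].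
      apply: leq_trans leAn; apply: proper_card.
      rewrite properE subsetDl; apply/subsetPn.
      have [y yS] := set0Pn _ S_neq0.
      by exists y; rewrite ?inE ?yS // (fintype.subsetP sSA).
    by rewrite rel_image_exclude hallD.
  have f2B y : y \in A -> y \notin S -> r y (f2 y) /\ f2 y \notin B.
    by move=> yA yS; apply/andP/rf2; rewrite inE yS.
  exists (fun y => if y \in S then f1 y else f2 y) => [y z yA zA|y yA] /=.
    case: ifPn => yS; case: ifPn => zS.
    - exact: inj1.
    - by move=> yz; have [_] := f2B _ zA zS; rewrite -yz f1B.
    - by move=> yz; have [_] := f2B _ yA yS; rewrite yz f1B.
    - by apply: inj2; rewrite inE ?yS ?zS.
  by case: ifPn => yS; [exact: rf1|have [] := f2B _ yA yS].
have [/existsP[S /and3P[S_neq0 prSA /eqP tightS]]|loose] :=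
  boolP [exists S : {set T},
    [&& S != finset.set0, S \proper A & #|rel_image r S| == #|S|]].
- have sSA := proper_sub prSA.
  have [f1 inj1 rf1] : exists2 f : T -> U,
      {in S &, injective f} & {in S, forall x, r x (f x)}.
    apply: IHn => [|S' sS']; first exact: leq_trans (proper_card prSA) leAn.
    exact/hallA/(fintype.subset_trans sS').
  exists S, (rel_image r S); split=> // [S'|]; last first.
    by exists f1; split=> // y yS; apply/rel_imageP; exists y => //; exact: rf1.
  rewrite subsetD => /andP[sS'A disS'].
  (* Hall's condition for the disjoint union, minus the equality for the tight set [S], is the
     condition for [S'] outside [rel_image r S]. *)
  have := hallA (S' :|: S); rewrite subUset sS'A sSA => /(_ isT).
  have /eqP-> : #|S' :|: S| == (#|S'| + #|S|)%N by rewrite (leq_card_setU S' S).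
  rewrite rel_imageU -tightS -(cardsID (rel_image r S) (_ :|: _)).
  rewrite finset.setIC finset.setKU.
  by rewrite addnC leq_add2l finset.setDUl finset.setDv finset.setU0.
- have [u /rel_imageP[x' /set1P-> rxu]] :
      exists u, u \in rel_image r [set x]%SET.
    by apply/card_gt0P; rewrite -(cards1 x) hallA // sub1set.
  exists [set x]%SET, [set u]%SET; split.
  + by apply/set0Pn; exists x; rewrite inE.
  + by rewrite sub1set.
  + move=> S' sS'; have [->|S'_neq0] := eqVneq S' finset.set0.
      by rewrite cards0.
    have prS' : S' \proper A.
      apply/properP; split.
        exact: fintype.subset_trans sS' (subsetDl _ _).
      by exists x => //; apply/negP => /(fintype.subsetP sS'); rewrite !inE eqxx.
    (* [S'] is not tight, so its image has an element to spare for the loss of [u]. *)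
    have := hallA _ (proper_sub prS'); rewrite leq_eqVlt => /orP[/eqP tightS'|].
      by case/existsP: loose; exists S'; rewrite S'_neq0 prS' -tightS' eqxx.
    rewrite (cardsD1 u); lia.
  + exists (fun=> u); split=> [y z /set1P-> /set1P->|y /set1P->|y _] //.
    by rewrite inE.
Qed.

Theorem hall r :
  (forall S, (#|S| <= #|rel_image r S|)%N) ->
  exists f : T -> U, injective f /\ forall x, r x (f x).
Proof.
(* If [U] is empty, the condition on singletons makes [T] empty too. *)
move=> hallr; have [u0|U0] := pickP U; last first.
  have T0 : T -> False.
    move=> x; have := hallr [set x]%SET; rewrite cards1 => /card_gt0P[u _].
    by have := U0 u.
  by exists (fun x => False_rect U (T0 x)); split=> x; case: (T0 x).
have [f injf rf] := hall_in u0 (A := [set: T]) (fun S _ => hallr S).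
by exists f; split=> [x y|x]; [apply: injf|apply: rf]; rewrite inE.
Qed.

End Hall.

(** * Independent sets and injections along edges *)

Section Independence.
Variable G : sgraph.
Implicit Types (I : {set G}) (u v : G).

Lemma independentP I :
  reflect {in I &, forall u v, ~~ adj u v} (independent I).
Proof.
apply: (iffP forall_inP) => [indI u v uI|indI u uI].
  by move/forall_inP: (indI u uI); apply.
by apply/forall_inP=> v; apply: indI.
Qed.

Lemma neighborhoodP I v :
  reflect (exists2 u, u \in I & adj u v) (v \in neighborhood I).
Proof. by rewrite inE; apply: exists_inP. Qed.

Lemma independence_numberP :
  exists2 I : {set G}, independent I & independence_number G = #|I|.
Proof.
have [|I] := @eq_bigmax_cond _ (@independent G) (fun I => #|I|); last first.
  by exists I.
by apply/card_gt0P; exists finset.set0; apply/independentP => u; rewrite inE.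
Qed.

Lemma independence_number_max I :
  independent I -> (#|I| <= independence_number G)%N.
Proof. exact: (@leq_bigmax_cond _ (@independent G) (fun I => #|I|)). Qed.

Definition expanding :=
  forall I, independent I -> (#|I| <= #|neighborhood I|)%N.

(** As [G] is finite, [s] is a permutation; its orbits cover [G] by disjoint edges and cycles. *)
Definition adj_injection (s : G -> G) :=
  injective s /\ forall v, adj v (s v).

(* In a set S, the vertices with a neighbour in S lie in N(S), and the other
   ones form an independent set whose neighbours lie outside S: so Hall's
   condition holds as soon as it holds for independent sets. *)
Lemma expanding_injection : expanding -> exists s, adj_injection s.
Proof.
move=> expG; apply: (@hall _ _ (@adj G)) => S.
set N := rel_image _ _; pose I := S :\: N.
have indI : independent I.
  apply/independentP => u v /setDP[uS _] /setDP[_ vN].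
  by apply: contra vN => uv; apply/rel_imageP; exists u.
have sIN : neighborhood I \subset N :\: S.
  apply/fintype.subsetP => v /neighborhoodP[u /setDP[uS uN] uv].
  rewrite inE; apply/andP; split; last by apply/rel_imageP; exists u.
  by apply: contra uN => vS; apply/rel_imageP; exists v; rewrite // adj_sym.
(* [S] and [N] share [S :&: N], so only [S :\: N] and [N :\: S] need comparing. *)
rewrite -(cardsID N S) -(cardsID S N) finset.setIC leq_add2l.
exact: leq_trans (expG _ indI) (subset_leq_card sIN).
Qed.

Lemma adj_injection_independence s :
  adj_injection s -> (independence_number G * 2 <= #|G|)%N.
Proof.
move=> [injs adjs]; have [I /independentP indI ->] := independence_numberP.
have : [set s u | u in I]%SET \subset ~: I.
  apply/fintype.subsetP=> _ /imsetP[u uI ->]; rewrite inE.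
  by apply: contraL (adjs u) => /(indI u); apply.
move/subset_leq_card; rewrite card_imset // -(cardsC I); lia.
Qed.

End Independence.

(** * Tensor powers *)

Lemma tensor_adj_injection (G H : sgraph) (s : G -> G) (t : H -> H) :
  adj_injection s -> adj_injection t ->
  @adj_injection (tensor G H) (fun p => (s p.1, t p.2)).
Proof.
move=> [injs adjs] [injt adjt]; split=> [[a b] [c d] /= [/injs-> /injt->] //|].
by move=> [a b]; rewrite /= /tensor_adj /= adjs adjt.
Qed.

Lemma tensor_powerS (G : sgraph) n :
  tensor_power G n.+2 = tensor G (tensor_power G n.+1).
Proof. by []. Qed.

Lemma card_tensor_power (G : sgraph) n : #|tensor_power G n.+1| = (#|G| ^ n.+1)%N.
Proof. by elim: n => // n IHn; rewrite tensor_powerS card_prod IHn -expnS. Qed.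

Lemma tensor_power_adj_injection (G : sgraph) (s : G -> G) n :
  adj_injection s -> exists t : tensor_power G n -> _, adj_injection t.
Proof.
(* The powers at 0 and 1 are both [G], so the induction starts at 1. *)
move=> adjs; case: n => [|n]; first by exists s.
elim: n => [|n [t adjt]]; first by exists s.
rewrite tensor_powerS; exists (fun p => (s p.1, t p.2)).
exact: tensor_adj_injection.
Qed.

(** * Independence ratios and their limit *)

Section Ratio.
Variable R : realType.
Implicit Types G H : sgraph.

Lemma independence_ratio_le1 G : independence_ratio R G <= 1.
Proof.
have [I _ IE] := independence_numberP G; rewrite /independence_ratio IE.
have [G0|G_gt0] := posnP #|G|; first by rewrite G0 invr0 mulr0.
by rewrite ler_pdivrMr ?ltr0n // mul1r ler_nat max_card.
Qed.

Lemma adj_injection_ratio G (s : G -> G) :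
  adj_injection s -> independence_ratio R G <= 1 / 2.
Proof.
move=> /adj_injection_independence; rewrite -(ler_nat R) natrM => leG.
rewrite /independence_ratio.
have [G0|G_gt0] := posnP #|G|; first by rewrite G0 invr0 mulr0; lra.
by rewrite ler_pdivrMr ?ltr0n //; lra.
Qed.

(** The preimage of an independent set under the projection to [H] is independent and has the same
    density. *)
Lemma independence_ratio_tensor G H :
  (0 < #|G|)%N -> independence_ratio R H <= independence_ratio R (tensor G H).
Proof.
move=> G_gt0; have [I /independentP indI IE] := independence_numberP H.
have indGI : @independent (tensor G H) (finset.setX [set: G] I).
  apply/independentP => -[a b] [c d] /setXP[_ bI] /setXP[_ dI].
  by rewrite /= /tensor_adj /= (negPf (indI _ _ bI dI)) andbF.
have := independence_number_max indGI; rewrite cardsX cardsT => leGI.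
rewrite /independence_ratio IE card_prod.
have [->|H_gt0] := posnP #|H|; first by rewrite muln0 !invr0 !mulr0.
rewrite ler_pdivrMr ?ltr0n // mulrAC ler_pdivlMr ?ltr0n ?muln_gt0 ?G_gt0 //.
by rewrite -!natrM ler_nat mulnA leq_mul2r mulnC leGI orbT.
Qed.

Lemma independence_ratio_cvg G :
  cvgn (fun n => independence_ratio R (tensor_power G n)).
Proof.
have [G0|G_gt0] := posnP #|G|.
  suff -> : (fun n => independence_ratio R (tensor_power G n)) = cst 0.
    exact: is_cvg_cst.
  apply/funext => -[|n]; rewrite /independence_ratio ?card_tensor_power G0.
    by rewrite invr0 mulr0.
  by rewrite exp0n // invr0 mulr0.
apply: nondecreasing_is_cvgn.
  apply/nondecreasing_seqP => -[|n]; first by [].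
  by rewrite tensor_powerS; apply: independence_ratio_tensor.
by exists 1 => _ [n _ <-]; apply: independence_ratio_le1.
Qed.

Lemma adj_injection_limit G (s : G -> G) :
  adj_injection s -> limit_independence_ratio R G <= 1 / 2.
Proof.
move=> adjs; apply: limr_le; first exact: independence_ratio_cvg.
apply: nearW => n; have [t adjt] := tensor_power_adj_injection n adjs.
exact: adj_injection_ratio adjt.
Qed.

End Ratio.

(** * Multiplicative weights *)

Section Weights.
Variable R : realType.
Implicit Types G H : sgraph.

(** A vertex cover in multiplicative form: the product condition on edges passes to tensor
    products. *)
Definition covering_weight G (w : G -> R) :=
  (forall u, 0 <= w u) /\ (forall u v, adj u v -> 1 <= w u * w v).

(* The vertices of weight < 1 form an independent set. *)
Lemma covering_weight_ratio G (w : G -> R) : (0 < #|G|)%N ->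
  covering_weight w -> 1 - (\sum_u w u) / #|G|%:R <= independence_ratio R G.
Proof.
move=> G_gt0 [w_ge0 w_adj]; pose J := [set u | w u < 1]%SET.
have /independence_number_max : independent J.
  apply/independentP => u v; rewrite !inE => wu wv.
  by apply: contraL (mulr_ilt1 (w_ge0 u) (w_ge0 v) wu wv) => /w_adj; rewrite leNgt.
rewrite -(ler_nat R) => leJ.
rewrite /independence_ratio ler_pdivlMr ?ltr0n // mulrBl mul1r divfK; last first.
  by rewrite pnatr_eq0 -lt0n.
apply: le_trans leJ; rewrite lerBlDr -(cardsC J) natrD lerD2l.
(* Markov's inequality: each vertex outside [J] has weight at least 1. *)
rewrite -sumr_const big_mkcond; apply: ler_sum => u _; rewrite !inE -leNgt.
by case: ifP.
Qed.

Lemma tensor_covering_weight G H (w : G -> R) (w' : H -> R) :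
  covering_weight w -> covering_weight w' ->
  @covering_weight (tensor G H) (fun p => w p.1 * w' p.2).
Proof.
move=> [w_ge0 w_adj] [w'_ge0 w'_adj]; split=> [p|p q /andP[/w_adj pq /w'_adj pq']].
  exact: mulr_ge0.
by rewrite mulrACA -[leLHS]mulr1 ler_pM.
Qed.

(** The total of a product weight factors, so the average weight on a power is the power of the
    average. *)
Lemma tensor_power_covering_weight G (w : G -> R) n : covering_weight w ->
  exists2 w' : tensor_power G n.+1 -> R, covering_weight w' &
    \sum_p w' p = (\sum_u w u) ^+ n.+1.
Proof.
move=> cov; elim: n => [|n [w' cov' sumE]]; first by exists w; rewrite ?expr1.
exists (fun p : tensor G (tensor_power G n.+1) => w p.1 * w' p.2).
  exact: tensor_covering_weight.
by rewrite exprS -sumE big_distrlr /= pair_bigA.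
Qed.

Lemma covering_weight_limit G (w : G -> R) :
  covering_weight w -> \sum_u w u < #|G|%:R ->
  limit_independence_ratio R G = 1.
Proof.
move=> cov lt_wG.
have w_ge0 : 0 <= \sum_u w u by apply: sumr_ge0 => u _; case: cov.
have G_gt0 : 0 < #|G|%:R :> R by apply: le_lt_trans lt_wG.
pose rho := (\sum_u w u) / #|G|%:R.
have rho_ge0 : 0 <= rho by rewrite divr_ge0 // ltW.
have rho_lt1 : rho < 1 by rewrite ltr_pdivrMr // mul1r.
(* The shift skips the dummy term at 0, so that the term at [n] is the power with [n.+1] factors. *)
apply/cvg_lim => //; rewrite -cvg_shiftS.
have rho_cvg : (rho ^+ n.+1 @[n --> \oo] --> (0 : R))%classic.
  by rewrite (cvg_shiftS (fun n => rho ^+ n)); apply: cvg_expr; rewrite ger0_norm.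
have lo : (1 - rho ^+ n.+1 @[n --> \oo] --> (1 : R))%classic.
  by have := cvgB (cvg_cst (1 : R)) rho_cvg; rewrite subr0; apply.
apply: (squeeze_cvgr _ lo (cvg_cst _)); apply: nearW => n /=.
rewrite independence_ratio_le1 andbT.
have [w' cov' sumE] := tensor_power_covering_weight n cov.
have := covering_weight_ratio _ cov'.
rewrite sumE card_tensor_power natrX -expr_div_n.
by apply; rewrite expn_gt0 -(ltr0n R) G_gt0.
Qed.

(* Weights t on I, 1/t on N(I) and 1 elsewhere: the sum is below |G| for t < 1
   close to 1, and t = (1 + |N(I)| / |I|) / 2 works. *)
Lemma contracting_limit G (I : {set G}) : independent I ->
  (#|neighborhood I| < #|I|)%N -> limit_independence_ratio R G = 1.
Proof.
move=> /independentP indI ltNI; set N := neighborhood I in ltNI.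
have I_gt0 : 0 < #|I|%:R :> R by rewrite ltr0n (leq_ltn_trans _ ltNI).
have {}ltNI : #|N|%:R < #|I|%:R :> R by rewrite ltr_nat.
pose t : R := (1 + #|N|%:R / #|I|%:R) / 2.
have q_lt1 : #|N|%:R / #|I|%:R < 1 :> R by rewrite ltr_pdivrMr // mul1r.
have q_ge0 : 0 <= #|N|%:R / #|I|%:R :> R by [].
have t_gt0 : 0 < t by rewrite /t; lra.
have t_lt1 : t < 1 by rewrite /t; lra.
(* [t] is the midpoint of [#|N| / #|I|] and 1, hence exceeds that quotient. *)
have Nt : #|N|%:R < #|I|%:R * t.
  by rewrite mulrC -ltr_pdivrMr // /t; lra.
have t1_gt1 : 1 < t^-1 by rewrite invf_gt1.
have disj u : u \in I -> u \in N = false.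
  move=> uI; apply/negP => /neighborhoodP[v vI vu].
  by have := indI _ _ vI uI; rewrite vu.
pose w u : R := if u \in I then t else if u \in N then t^-1 else 1.
apply: (@covering_weight_limit _ w).
  split=> [u|u v uv]; first by rewrite /w; case: ifP => _; last case: ifP => _ //; lra.
  have memN x y : x \in I -> adj x y -> y \in N.
    by move=> xI xy; apply/neighborhoodP; exists x.
  have wN y : y \in N -> w y = t^-1.
    by move=> yN; rewrite /w yN; case: ifP => // /disj; rewrite yN.
  have w_ge1 x : x \notin I -> 1 <= w x.
    by move=> /negPf xI; rewrite /w xI; case: ifP => _ //; lra.
  (* An edge meeting [I] has its other end in [N], with product exactly 1; on any other edge both
     weights are at least 1. *)
  have [uI|uI] := boolP (u \in I).
    by rewrite (wN v) ?(memN u) // /w uI divff // gt_eqF.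
  have [vI|vI] := boolP (v \in I).
    by rewrite (wN u) ?(memN v) ?(adj_sym v) // /w vI mulVf // gt_eqF.
  by rewrite -[leLHS]mulr1 ler_pM // w_ge1.
have wE u : w u = 1 - (u \in I)%:R * (1 - t) + (u \in N)%:R * (t^-1 - 1).
  rewrite /w; case: ifP => [/disj->|_]; first by rewrite mulr1n mulr0n; ring.
  by case: ifP => _; rewrite mulr0n ?mulr1n; ring.
have sum_mem (A : {set G}) : \sum_u (u \in A)%:R = #|A|%:R :> R.
  by rewrite -sum1_card natr_sum [RHS]big_mkcond; apply: eq_bigr => u _; case: ifP.
rewrite (eq_bigr _ (fun u _ => wE u)) big_split sumrB /= -!mulr_suml !sum_mem.
rewrite sumr_const.
(* The total falls short of [#|G|] by [(#|I| - #|N| / t) * (1 - t)]. *)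
have -> : #|N|%:R * (t^-1 - 1) = #|N|%:R / t * (1 - t) by field; rewrite gt_eqF.
suff : 0 < (#|I|%:R - #|N|%:R / t) * (1 - t) by rewrite mulrBl; lra.
by rewrite mulr_gt0 ?subr_gt0 // ltr_pdivrMr.
Qed.

End Weights.

(** * Fractional perfect matchings and expansion *)

Section FractionalMatching.
Variables (R : realType) (G : sgraph).
Implicit Types (A I : {set G}) (E : {set G}) (u v : G) (f : {set G} -> R).

Lemma edgesP E :
  reflect (exists p, adj p.1 p.2 /\ E = [set p.1; p.2]%SET) (E \in edges G).
Proof. by apply: (iffP imsetP) => [[p]|[p []]]; exists p. Qed.

Lemma adj_neq u v : adj u v -> u != v.
Proof. by apply: contraTneq => ->; rewrite adj_irr. Qed.

Lemma cardsI2 A u v : u != v ->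
  #|A :&: [set u; v]%SET| = ((u \in A) + (v \in A))%N.
Proof.
move=> uv; rewrite (cardsD1 u) (cardsD1 v) !inE eqxx andbT (eq_sym v) uv eqxx.
rewrite orbT andbT addnA -[RHS]addn0; congr addn; apply: eq_card0 => z.
by rewrite !inE; case: (z == u); case: (z == v); rewrite //= ?andbF.
Qed.

(** Double counting of the incidences between vertices of [A] and edges. *)
Lemma sum_incidence f A :
  \sum_(v in A) \sum_(E in edges G | v \in E) f E =
  \sum_(E in edges G) f E *+ #|A :&: E|.
Proof.
rewrite (exchange_big_dep (mem (edges G))) /=; last by move=> v E _ /andP[].
apply: eq_bigr => E EG; rewrite -sumr_const.
by apply: eq_bigl => v; rewrite inE EG.
Qed.

Lemma perfect_matching_expanding f :
  fractional_perfect_matching f -> expanding G.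
Proof.
move=> [[f_ge0 f_le1] f_perf] I /independentP indI.
pose s v := \sum_(E in edges G | v \in E) f E.
have sum_s : \sum_v s v = #|G|%:R.
  have := sum_incidence f [set: G]; under eq_bigl do rewrite inE.
  rewrite -/s => ->; transitivity (\sum_(E in edges G) f E * 2).
    apply: eq_bigr => _ /edgesP[p [/adj_neq pE ->]].
    by rewrite cardsI2 // !inE mulr_natr.
  by rewrite -mulr_suml f_perf divfK.
(* The sums [s v] are at most 1 and add up to [#|G|], so all are equal to 1. *)
have s1 v : s v = 1.
  apply/esym/eqP; rewrite -subr_eq0; apply/eqP.
  apply: (@psumr_eq0P _ _ predT (fun v => 1 - s v)) => // [u _|].
    by rewrite subr_ge0 f_le1.
  by rewrite sumrB sum_s sumr_const subrr.
have cardE A : #|A|%:R = \sum_(E in edges G) f E *+ #|A :&: E|.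
  by rewrite -sum_incidence -sumr_const; apply: eq_bigr => v _; rewrite -/(s v) s1.
rewrite -(ler_nat R) !cardE; apply: ler_sum => E EG.
rewrite -mulr_natr -[leRHS]mulr_natr; apply: ler_wpM2l; first exact: f_ge0.
rewrite ler_nat.
have /edgesP[[u v] /= [uv ->]] := EG.
rewrite !cardsI2 ?adj_neq //.
have memN x y : x \in I -> adj x y -> y \in neighborhood I.
  by move=> xI xy; apply/neighborhoodP; exists x.
(* An edge has at most one end in [I], and then its other end is in [neighborhood I]. *)
have [uI|_] := boolP (u \in I).
  rewrite (memN u v) //; have [vI|_] := boolP (v \in I); last exact: leq_addl.
  by have := indI _ _ uI vI; rewrite uv.
by have [vI|//] := boolP (v \in I); rewrite (memN v u) ?(adj_sym v).
Qed.

Lemma adj_injection_perfect_matching (s : G -> G) :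
  adj_injection s -> exists f, @fractional_perfect_matching R G f.
Proof.
move=> [injs adjs]; pose e v := [set v; s v]%SET.
have eG v : e v \in edges G by apply/edgesP; exists (v, s v).
(* Each vertex [v] gives 1/2 to [e v]; an edge whose ends are swapped by [s] receives 1. *)
pose f E : R := (\sum_v (E == e v)%:R) / 2.
have sum_f (P : pred {set G}) :
    \sum_(E in edges G | P E) f E = (\sum_v (P (e v))%:R) / 2.
  rewrite -mulr_suml exchange_big /=; congr (_ / 2); apply: eq_bigr => v _.
  have [Pv|Pv] := boolP (P (e v)).
    rewrite (bigD1 (e v)) /= ?eG ?Pv // eqxx big1 ?addr0 // => E /andP[_ /negPf->//].
  rewrite big1 // => E /andP[_ PE]; case: eqVneq => // EE.
  by rewrite -EE PE in Pv.
exists f; split; last first.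
  have := sum_f predT; rewrite /= sumr_const => <-.
  by apply: eq_bigl => E; rewrite andbT.
split=> [E _|v]; first by rewrite divr_ge0 // sumr_ge0.
rewrite (sum_f (fun E => v \in E)) ler_pdivrMr // mul1r.
have sum1 (P : pred G) : {in P &, forall x y, x = y} -> \sum_x (P x)%:R <= 1 :> R.
  move=> uniqP; have [x Px|P0] := pickP P; last by rewrite big1 // => x _; rewrite P0.
  rewrite (bigD1 x) //= big1 ?Px ?addr0 // => y; have [Py|//] := boolP (P y).
  by rewrite (uniqP x y) ?eqxx.
(* [v] lies in [e x] only if [x = v] or [s x = v], and each holds for at most one [x]. *)
apply: (@le_trans _ _ (\sum_x (x == v)%:R + \sum_x (s x == v)%:R)).
  rewrite -big_split; apply: ler_sum => x _ /=; rewrite !inE (eq_sym x) (eq_sym (s x)).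
  by do 2!case: eqP => _; rewrite ?addr0 ?add0r // lerDl.
apply: lerD; apply: sum1 => x y /eqP xv /eqP yv; first by rewrite xv.
by apply: injs; rewrite xv.
Qed.

Lemma max_expansion_ratio_le_half :
  max_expansion_ratio R G <= 1 / 2 <-> expanding G.
Proof.
have ratioE I : I != finset.set0 ->
    (#|I|%:R / (#|I| + #|neighborhood I|)%:R <= 1 / 2 :> R)
      = (#|I| <= #|neighborhood I|)%N.
  rewrite -card_gt0 => I_gt0; rewrite ler_pdivrMr ?ltr0n ?addn_gt0 ?I_gt0 //.
  by rewrite -[RHS](ler_nat R) natrD; apply/idP/idP; lra.
split=> [/bigmax_leP[_ leI] I indI|expG].
  have [->|I_neq0] := eqVneq I finset.set0; first by rewrite cards0.
  by rewrite -ratioE // leI // indI.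
apply/bigmax_leP; split=> [|I /andP[indI I_neq0]]; first by lra.
by rewrite ratioE // expG.
Qed.

Lemma max_expansion_ratio_starP :
  max_expansion_ratio_star R G = 1 <-> ~ expanding G.
Proof.
rewrite -max_expansion_ratio_le_half /max_expansion_ratio_star.
by case: ifP => [le_half|//]; split=> [|/(_ isT)//]; lra.
Qed.

End FractionalMatching.

(** * The cycle of implications *)

Theorem theorem2p1 (R : realType) (G : sgraph) :
  [<-> limit_independence_ratio R G = 1;
       max_expansion_ratio_star R G = 1;
       ~ exists f : {set G} -> R, fractional_perfect_matching f].
Proof.
tfae.
- move=> lim1; apply/max_expansion_ratio_starP => /expanding_injection[s adjs].
  by have := adj_injection_limit R adjs; rewrite lim1; lra.
- move=> /max_expansion_ratio_starP nexpG [f] /perfect_matching_expanding.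
  exact: nexpG.
- move=> noPM.
  have [/existsP[I /andP[indI]]|expG] := boolP [exists I : {set G},
      independent I && (#|neighborhood I| < #|I|)%N].
    exact: contracting_limit.
  case: noPM; have [|s] := @expanding_injection G.
    move=> I indI; rewrite leqNgt; apply: contra expG => ltNI.
    by apply/existsP; exists I; rewrite indI.
  exact: adj_injection_perfect_matching.
Qed.
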